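(* Let $\mathbb{G}$ be a homogeneous Lie group with homogeneous dimension $Q$ and let $|\cdot|$ be a homogeneous quasi-norm on $\mathbb{G}$. Let $\alpha\in(1,\infty)$ and let $\alpha'$ be given by $\frac{1}{\alpha}+\frac{1}{\alpha'}=1$. Then for every $u\in L^{1,\alpha}(\mathbb{G})\setminus\{0\}$ we have $$\int_{\mathbb{G}}\frac{|u(x)|}{\|u\|_{L^{1}(\mathbb{G})}}\log\left(\left(\frac{|u(x)|}{\|u\|_{L^{1}(\mathbb{G})}}\right)^{-1}\right)dx\leq \frac{Q}{\alpha}\log\left(\frac{B_{Q,\alpha}}{\|u\|_{L^{1}(\mathbb{G})}}\,\||\cdot|^{\alpha}u\|_{L^{1}(\mathbb{G})}\right),$$ where $$B_{Q,\alpha}=\alpha^{\alpha}(\alpha-1)^{1-\alpha}\left(\frac{|\mathfrak{S}|\,\Gamma\left(\frac{Q}{\alpha}\right)\Gamma\left(\frac{Q}{\alpha'}\right)}{\alpha\,\Gamma(Q)}\right)^{\frac{\alpha}{Q}}.$$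
   Context: A homogeneous (Lie) group $\mathbb{G}$ is a Lie group on $\mathbb{R}^{N}$ (with identity $0$) equipped with dilations $D_{\lambda}(x)=(\lambda^{\nu_{1}}x_{1},\ldots,\lambda^{\nu_{N}}x_{N})$, $\nu_{1},\ldots,\nu_{N}>0$, which are automorphisms of $\mathbb{G}$ for each $\lambda>0$; one writes $\lambda x$ for $D_{\lambda}(x)$. Its homogeneous dimension is $Q=\nu_{1}+\cdots+\nu_{N}$. The Haar measure $dx$ on $\mathbb{G}$ is the Lebesgue measure on $\mathbb{R}^{N}$, and $L^{p}(\mathbb{G})$ is taken with respect to it. A homogeneous quasi-norm on $\mathbb{G}$ is a continuous function $\mathbb{G}\ni x\mapsto|x|\in[0,\infty)$ such that (a) $|x|=|x^{-1}|$ for all $x\in\mathbb{G}$; (b) $|\lambda x|=\lambda|x|$ for all $x\in\mathbb{G}$, $\lambda>0$; (c) $|x|=0$ if and only if $x=0$. The unit quasi-sphere is $\mathfrak{S}=\{x\in\mathbb{G}:|x|=1\}$. There is a unique Radon measure $\sigma$ on $\mathfrak{S}$ such that $\int_{\mathbb{G}}f(x)\,dx=\int_{0}^{\infty}\int_{\mathfrak{S}}f(ry)r^{Q-1}\,d\sigma(y)\,dr$ for all $f\in L^{1}(\mathbb{G})$, and $|\mathfrak{S}|=\sigma(\mathfrak{S})$ denotes the $(Q-1)$-dimensional surface measure of the unit quasi-sphere. The weighted space is $L^{p,\alpha}(\mathbb{G})=\{u: u\in L^{p}_{loc}(\mathbb{G}),\ \langle x\rangle^{\alpha}u\in L^{p}(\mathbb{G})\}$,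 $\alpha>0$, where $\langle x\rangle=(1+|x|^{2})^{1/2}$. $\Gamma$ is the Euler Gamma function. The usual convention $0\log(1/0)=0$ is used, and the integral on the left-hand side is understood as an extended real number (possibly $-\infty$). *)

(* Defs.v *)
From HB Require Import structures.
From mathcomp Require Import all_boot all_order all_algebra complex.
From mathcomp Require Import all_classical all_reals all_analysis.

Set Implicit Arguments.
Unset Strict Implicit.
Unset Printing Implicit Defensive.
Import Order.TTheory GRing.Theory Num.Theory.
Import numFieldNormedType.Exports.
Local Open Scope classical_set_scope.
Local Open Scope ring_scope.

Definition borel_rV_display : measure_display.
Proof. exact: default_measure_display. Qed.

Section borel_rV.
Context {R : realType} {N : nat}.

Let borel : set (set 'rV[R]_N) := <<s @open 'rV[R]_N >>.

Let borel0 : borel set0. Proof. exact: sigma_algebra0. Qed.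

Let borelC A : borel A -> borel (~` A). Proof. exact: sigma_algebraC. Qed.

Let borel_bigcup (F : (set 'rV[R]_N)^nat) :
  (forall i, borel (F i)) -> borel (\bigcup_i F i).
Proof. exact: sigma_algebra_bigcup. Qed.

HB.instance Definition _ := @isMeasurable.Build borel_rV_display 'rV[R]_N
  borel borel0 borelC borel_bigcup.

Lemma open_measurable_rV (U : set 'rV[R]_N) : open U -> measurable U.
Proof. exact: sub_sigma_algebra. Qed.

Lemma continuous_measurable_rV (f : 'rV[R]_N -> R) :
  continuous f -> measurable_fun [set: 'rV[R]_N] f.
Proof.
move=> /continuousP cf; apply: (measurability _ (measurable_realfun.RGenOpens.measurableE R)).
move=> _ [_ [a [b ->] <-]]; rewrite setTI.
by apply: open_measurable_rV; apply: cf; exact: interval_open.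
Qed.

Lemma open_bigcup_ball_rV (U : set 'rV[R]_N) : open U ->
  U = \bigcup_(p in [set p : 'rV[rat]_N * nat |
        ball (map_mx ratr p.1 : 'rV[R]_N) p.2.+1%:R^-1 `<=` U])
      ball (map_mx ratr p.1 : 'rV[R]_N) p.2.+1%:R^-1.
Proof.
move=> oU; apply/seteqP; split=> [x Ux|x [p pU]]; last exact: pU.
have /nbhs_ballP[e /= e0 eU] : nbhs x U by exact: open_nbhs_nbhs.
have [n ne] : exists n : nat, (n.+1%:R^-1 : R) < e / 2.
  have := near_infty_natSinv_lt (PosNum (divr_gt0 e0 (ltr0n R 2))).
  by case=> n _ /(_ n (leqnn n)); exists n.
have n0 : (0 : R) < n.+1%:R^-1 by rewrite invr_gt0.
have /choice[q Hq] : forall i : 'I_N, exists q : rat,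
    `|ratr q - x ord0 i| < n.+1%:R^-1.
  move=> i; have : x ord0 i - n.+1%:R^-1 < x ord0 i + n.+1%:R^-1.
    by rewrite ltrBlDr -addrA ltrDl addr_gt0.
  move=> /rat_in_itvoo[q]; rewrite in_itv/= => /andP[q1 q2].
  by exists q; rewrite ltr_distl q1 q2.
have qx : ball (map_mx ratr (\row_i q i) : 'rV[R]_N) n.+1%:R^-1 x.
  by split=> // i j; rewrite !mxE ord1 /ball/=; exact: Hq.
exists (\row_i q i, n) => //= y qy; apply: eU.
apply: (@le_ball _ _ _ (n.+1%:R^-1 + n.+1%:R^-1)); first by rewrite [leRHS]splitr lerD // ltW.
by apply: ball_triangle qy; exact: ball_sym.
Qed.

Lemma measurable_fun_rV d (T : measurableType d) (f : T -> 'rV[R]_N) :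
  (forall i, measurable_fun [set: T] (fun x => f x ord0 i)) ->
  measurable_fun [set: T] f.
Proof.
move=> mf; apply: (@measurability _ _ _ _ _ _ (@open 'rV[R]_N)) => //.
move=> _ [U oU <-]; rewrite setTI (open_bigcup_ball_rV oU) preimage_bigcup.
rewrite bigcup_mkcond; apply: countable_bigcupT_measurable => // -[q n].
case: ifPn => // _.
have -> : f @^-1` ball (map_mx ratr (q, n).1 : 'rV[R]_N) (q, n).2.+1%:R^-1 =
    \bigcap_(i in [set: 'I_N])
      ((fun x => f x ord0 i) @^-1` ball (ratr (q ord0 i) : R) n.+1%:R^-1).
  apply/seteqP; split=> [x [_ qx] i _ /=|x qx].
    by have := qx ord0 i; rewrite mxE.
  split; first by rewrite /= invr_gt0.
  by move=> i j; rewrite mxE ord1; exact: qx.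
apply: fin_bigcap_measurable => // i _.
rewrite -[X in measurable X]setTI; apply: mf => //.
apply: measurable_realfun.open_measurable; apply: ball_open.
Qed.

End borel_rV.

Section lebesgue_rV.
Context {R : realType}.

Definition cons_rV N (p : R * 'rV[R]_N) : 'rV[R]_N.+1 :=
  row_mx (const_mx p.1 : 'rV[R]_1) p.2.

Definition uncons_rV N (x : 'rV[R]_N.+1) : R * 'rV[R]_N :=
  (x ord0 ord0, \row_i x ord0 (lift ord0 i)).

Lemma cons_rV0 N (p : R * 'rV[R]_N) : cons_rV p ord0 ord0 = p.1.
Proof.
rewrite /cons_rV (_ : ord0 = lshift N (ord0 : 'I_1)); last exact/val_inj.
by rewrite [LHS](row_mxEl (const_mx p.1 : 'rV[R]_1)) mxE.
Qed.

Lemma cons_rVS N (p : R * 'rV[R]_N) i :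
  cons_rV p ord0 (lift ord0 i) = p.2 ord0 i.
Proof.
rewrite /cons_rV (_ : lift ord0 i = rshift 1 i); last exact/val_inj.
by rewrite [LHS](row_mxEr (const_mx p.1 : 'rV[R]_1)).
Qed.

Lemma cons_rVK N : cancel (@cons_rV N) (@uncons_rV N).
Proof.
move=> p; rewrite /uncons_rV cons_rV0 [RHS]surjective_pairing; congr pair.
by apply/rowP => i; rewrite mxE cons_rVS.
Qed.

Lemma measurable_cons_rV N : measurable_fun [set: R * 'rV[R]_N] (@cons_rV N).
Proof.
apply: measurable_fun_rV => i; case: (unliftP ord0 i) => [j ->|->].
  rewrite (_ : (fun x => _) = (fun x : 'rV[R]_N => x ord0 j) \o snd).
    apply: measurableT_comp => //; apply: continuous_measurable_rV.
    exact: coord_continuous.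
  by apply/funext => x /=; rewrite cons_rVS.
rewrite (_ : (fun x => _) = fst)//.
by apply/funext => x /=; rewrite cons_rV0.
Qed.

Lemma measurable_uncons_rV N : measurable_fun [set: 'rV[R]_N.+1] (@uncons_rV N).
Proof.
apply: measurable_fun_pair.
  by apply: continuous_measurable_rV; exact: coord_continuous.
apply: measurable_fun_rV => i; under eq_fun do rewrite mxE.
by apply: continuous_measurable_rV; exact: coord_continuous.
Qed.

Section lebesgue_rVS.
Context {N : nat} (m : {sigma_finite_measure set 'rV[R]_N -> \bar R}).

Definition lebesgue_rVS : set 'rV[R]_N.+1 -> \bar R :=
  pushforward (lebesgue_measure \x m)%E (@cons_rV N).

Let measurable_preimage_cons (A : set 'rV[R]_N.+1) :
  measurable A -> measurable (@cons_rV N @^-1` A).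
Proof.
by move=> mA; rewrite -[X in measurable X]setTI; exact: measurable_cons_rV.
Qed.

Let lebesgue_rVS0 : lebesgue_rVS set0 = 0%E.
Proof. by rewrite /lebesgue_rVS /pushforward preimage_set0 measure0. Qed.

Let lebesgue_rVS_ge0 A : (0 <= lebesgue_rVS A)%E.
Proof. exact: (measure_ge0 (lebesgue_measure \x m)%E). Qed.

Let lebesgue_rVS_sigma_additive : semi_sigma_additive lebesgue_rVS.
Proof.
move=> F mF tF mUF; rewrite /lebesgue_rVS /pushforward preimage_bigcup.
apply: (@measure_semi_sigma_additive _ _ _ (lebesgue_measure \x m)%E).
- by move=> n; exact: measurable_preimage_cons.
- apply/trivIsetP => /= i j _ _ ij; rewrite -preimage_setI.
  by move/trivIsetP : tF => /(_ _ _ _ _ ij) ->//; rewrite preimage_set0.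
- by rewrite -preimage_bigcup; exact: measurable_preimage_cons.
Qed.

HB.instance Definition _ := isMeasure.Build _ _ _ lebesgue_rVS
  lebesgue_rVS0 lebesgue_rVS_ge0 lebesgue_rVS_sigma_additive.

Let lebesgue_rVS_sigma_finite : sigma_finite setT lebesgue_rVS.
Proof.
have /sigma_finiteP[F [UF ndF mF]] := sigma_finiteT (@lebesgue_measure R).
have /sigma_finiteP[G [UG ndG mG]] := sigma_finiteT m.
have mFG k : measurable (F k `*` G k).
  by have [? _] := mF k; have [? _] := mG k; exact: measurableX.
exists (fun k => @uncons_rV N @^-1` (F k `*` G k)).
  apply/seteqP; split=> // x _.
  have [i _ Fi] : (\bigcup_i F i) (uncons_rV x).1 by rewrite -UF.
  have [j _ Gj] : (\bigcup_i G i) (uncons_rV x).2 by rewrite -UG.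
  exists (maxn i j) => //; split.
    by move: Fi; apply/subsetPset/ndF/leq_maxl.
  by move: Gj; apply/subsetPset/ndG/leq_maxr.
move=> k; split.
  rewrite -[X in measurable X]setTI.
  by apply: measurable_uncons_rV => //; exact: mFG.
rewrite /lebesgue_rVS /pushforward -comp_preimage.
rewrite (_ : _ \o _ = id); last by apply/funext => p; exact: cons_rVK.
have [mFk Fkoo] := mF k; have [mGk Gkoo] := mG k.
rewrite preimage_id product_measure1E// lte_mul_pinfty// ge0_fin_numE//.
Qed.

HB.instance Definition _ := Measure_isSigmaFinite.Build _ _ _ lebesgue_rVS
  lebesgue_rVS_sigma_finite.

End lebesgue_rVS.

Fixpoint lebesgue_rV (N : nat) : {sigma_finite_measure set 'rV[R]_N -> \bar R} :=
  match N with
  | 0 => \d_(0 : 'rV[R]_0)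
  | N'.+1 => lebesgue_rVS (lebesgue_rV N')
  end.

Definition box_rV N (a b : 'rV[R]_N) : set 'rV[R]_N :=
  [set x | forall i, a ord0 i <= x ord0 i <= b ord0 i].

Lemma measurable_box_rV N (a b : 'rV[R]_N) : measurable (box_rV a b).
Proof.
rewrite (_ : box_rV a b = \bigcap_(i in [set: 'I_N])
    ((fun x : 'rV[R]_N => x ord0 i) @^-1` `[a ord0 i, b ord0 i])); last first.
  apply/seteqP; split=> [x abx i _ | x abx i]; last first.
    by have := abx i I; rewrite /= in_itv.
  by rewrite /= in_itv; exact: abx.
apply: fin_bigcap_measurable => // i _; rewrite -[X in measurable X]setTI.
by apply: continuous_measurable_rV => //; exact: coord_continuous.
Qed.

Lemma lebesgue_rV_box N (a b : 'rV[R]_N) :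
  (forall i, a ord0 i <= b ord0 i) ->
  lebesgue_rV N (box_rV a b) = (\prod_(i < N) (b ord0 i - a ord0 i))%:E.
Proof.
elim: N a b => [|N IH] a b ab.
  rewrite big_ord0 /= diracE mem_set//= => -[]//.
pose tl (x : 'rV[R]_N.+1) : 'rV[R]_N := (uncons_rV x).2.
have tlE x i : tl x ord0 i = x ord0 (lift ord0 i) by rewrite /tl /= mxE.
rewrite /= /lebesgue_rVS /pushforward.
rewrite (_ : _ @^-1` _ =
    `[a ord0 ord0, b ord0 ord0]%classic `*` box_rV (tl a) (tl b)); last first.
  apply/seteqP; split=> [p abp|p [/= + abp] i].
    split; first by rewrite /= in_itv/= -(cons_rV0 p); exact: abp.
    by move=> i; rewrite !tlE -cons_rVS; exact: abp.
  rewrite in_itv/= => p1; case: (unliftP ord0 i) => [j ->|->].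
    by rewrite cons_rVS -!tlE; exact: abp.
  by rewrite cons_rV0.
rewrite product_measure1E//; last exact: measurable_box_rV.
rewrite big_ord_recl EFinM; congr (_ * _)%E.
  rewrite [LHS]lebesgue_measure_itv/= lte_fin.
  by case: ltgtP (ab ord0) => // -> _; rewrite subrr.
rewrite IH; last by move=> i; rewrite !tlE.
by congr (_%:E); apply: eq_bigr => i _; rewrite !tlE.
Qed.

End lebesgue_rV.

Section lie_group.
Context {R : realType}.

(* For finite-dimensional V, requiring all directional derivatives 'D_v f to be
   of class C^k is the same as requiring the Frechet derivative to be. *)
Fixpoint class_C (k : nat) (V W : normedModType R) (f : V -> W) : Prop :=
  match k with
  | 0 => continuous f
  | k'.+1 => (forall x, differentiable f x) /\
             (forall v, class_C k' (fun x => 'D_v f x))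
  end.

Definition smooth (V W : normedModType R) (f : V -> W) : Prop :=
  forall k, class_C k f.

Definition dilation_rV N (nu : 'I_N -> R) (lambda : R) (x : 'rV[R]_N)
  : 'rV[R]_N := \row_i (lambda `^ nu i * x ord0 i).

Record homogeneous_group (N : nat) := HomogeneousGroup {
  hg_mul : 'rV[R]_N -> 'rV[R]_N -> 'rV[R]_N ;
  hg_inv : 'rV[R]_N -> 'rV[R]_N ;
  hg_weight : 'I_N -> R ;
  hg_mulA : associative hg_mul ;
  hg_mul0x : left_id 0 hg_mul ;
  hg_mulx0 : right_id 0 hg_mul ;
  hg_mulVx : left_inverse 0 hg_inv hg_mul ;
  hg_mulxV : right_inverse 0 hg_inv hg_mul ;
  hg_mul_smooth :
    smooth (fun p : 'rV[R]_N * 'rV[R]_N => hg_mul p.1 p.2 : 'rV[R]_N) ;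
  hg_inv_smooth : smooth hg_inv ;
  hg_weight_gt0 : forall i, 0 < hg_weight i ;
  hg_dilationM : forall lambda, 0 < lambda ->
    {morph dilation_rV hg_weight lambda : x y / hg_mul x y}
}.

Definition dilation N (G : homogeneous_group N) : R -> 'rV[R]_N -> 'rV[R]_N :=
  dilation_rV (hg_weight G).

Definition hom_dim N (G : homogeneous_group N) : R := \sum_(i < N) hg_weight G i.

Record is_quasi_norm N (G : homogeneous_group N) (qn : 'rV[R]_N -> R) : Prop :=
  IsQuasiNorm {
    qn_continuous : continuous qn ;
    qn_ge0 : forall x, 0 <= qn x ;
    qn_inv : forall x, qn (hg_inv G x) = qn x ;
    qn_dilation : forall lambda x, 0 < lambda ->
      qn (dilation G lambda x) = lambda * qn x ;
    qn_eq0 : forall x, qn x = 0 <-> x = 0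
  }.

Definition quasi_sphere N (qn : 'rV[R]_N -> R) : set 'rV[R]_N :=
  [set x | qn x = 1].

End lie_group.
Arguments homogeneous_group R N : clear implicits.

Section sphere_measure.
Context {R : realType} {N : nat}.
Implicit Types (S : set 'rV[R]_N) (sigma : {measure set 'rV[R]_N -> \bar R}).

(* A Borel measure on a Borel set S is represented by a Borel measure on R^N;
   only its values on subsets of S are ever used. *)
Definition radon_on S sigma : Prop :=
  (forall K, compact K -> K `<=` S -> (sigma K < +oo)%E) /\
  (forall A, measurable A -> A `<=` S ->
    sigma A = ereal_sup [set sigma K | K in [set K | compact K /\ K `<=` A]]).

Definition is_polar_measure (G : homogeneous_group R N) (qn : 'rV[R]_N -> R)
    sigma : Prop :=
  radon_on (quasi_sphere qn) sigma /\
  forall f : 'rV[R]_N -> R,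
    (lebesgue_rV N).-integrable [set: 'rV[R]_N] (EFin \o f) ->
    (\int[lebesgue_rV N]_x (f x)%:E =
     \int[lebesgue_measure]_(r in `]0%R, +oo[)
       \int[sigma]_(y in quasi_sphere qn)
         (f (dilation G r y) * r `^ (hom_dim G - 1))%:E)%E.

End sphere_measure.

Section weighted_Lebesgue_spaces.
Context {R : realType} {N : nat}.
Implicit Types (u : 'rV[R]_N -> R[i]) (p : R).

Definition cmodulus u (x : 'rV[R]_N) : R := Normc.normc (u x).

Definition cmeasurable u : Prop :=
  measurable_fun [set: 'rV[R]_N] (fun x => complex.Re (u x)) /\
  measurable_fun [set: 'rV[R]_N] (fun x => complex.Im (u x)).

(* The library's Lp seminorm is stated for real-valued functions, so that a
   complex-valued function is measured through its modulus. *)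
Definition Lp_norm p u : \bar R :=
  Lnorm (lebesgue_rV N) p%:E (EFin \o cmodulus u).

Definition in_Lp p u : Prop := cmeasurable u /\ (Lp_norm p u < +oo)%E.

Definition in_Lp_loc p u : Prop := cmeasurable u /\
  forall K, compact K ->
    (\int[lebesgue_rV N]_(x in K) (cmodulus u x `^ p)%:E < +oo)%E.

Definition japanese_bracket (qn : 'rV[R]_N -> R) (x : 'rV[R]_N) : R :=
  Num.sqrt (1 + qn x ^+ 2).

Definition in_weighted_Lp (qn : 'rV[R]_N -> R) p (alpha : R) u : Prop :=
  in_Lp_loc p u /\
  in_Lp p (fun x => (japanese_bracket qn x `^ alpha)%:C%C * u x).

End weighted_Lebesgue_spaces.

Section constant.
Context {R : realType}.

Definition Gamma (s : R) : R :=
  \int[lebesgue_measure]_(t in `]0%R, +oo[) (t `^ (s - 1) * expR (- t)).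

(* [S] is the total mass |S| of the unit quasi-sphere and [alpha'] the conjugate
   exponent of [alpha]; [Gamma] is meaningful on positive arguments only. *)
Definition B_const (Q alpha alpha' S : R) : R :=
  alpha `^ alpha * (alpha - 1) `^ (1 - alpha) *
  (S * Gamma (Q / alpha) * Gamma (Q / alpha') / (alpha * Gamma Q))
    `^ (alpha / Q).

End constant.

(* Main.v *)
Require Import Defs.
From HB Require Import structures.
From mathcomp Require Import all_boot all_order all_algebra complex.
From mathcomp Require Import all_classical all_reals all_analysis.
From mathcomp Require Import measurable_realfun ring.

Set Implicit Arguments.
Unset Strict Implicit.
Unset Printing Implicit Defensive.
Import Order.TTheory GRing.Theory Num.Theory.
Import numFieldNormedType.Exports.
Local Open Scope classical_set_scope.
Local Open Scope ring_scope.

(** Write [v = |u| / ||u||_1], a probability density, [rho = |x|^alpha], and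
let [M] be the [v]-mean of [rho].  Gibbs' inequality bounds the entropy of [v]
by the cross entropy [- \int v ln w] against any positive [w] of mass at most
[1].  The density fitted to the constraint on [M] is
[w(x) = s^(Q/alpha) (1 + s |x|^alpha)^(-Q) / I], where [s] is a free dilation
parameter.  Its cross entropy is
[ln I - (Q/alpha) ln s + Q \int v ln (1 + s rho)], and by concavity of [ln] the
last integral is at most [ln (1 + s M)].  The choice [s = 1 / ((alpha - 1) M)]
minimizes the bound, and the minimum is the right-hand side of the theorem, as
soon as the normalization [I] is
[|S| Gamma(Q/alpha) Gamma(Q/alpha') / (alpha Gamma(Q))].

That value comes from polar coordinates: [\int w] reduces to
[|S| \int_0^oo s^(Q/alpha) (1 + s r^alpha)^(-Q) r^(Q-1) dr], which the
substitution [t = s r^alpha] turns into Euler's Beta integral, and the Beta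
integral is a quotient of Gamma values by Tonelli's theorem
([Gamma_mul_beta], [integral_radial_profile]).

The polar formula is only given for integrable functions, so it is applied to
truncations to quasi-balls, which are bounded and hence of finite measure
([quasi_ball_bounded]); monotone convergence then gives [radial_integral_le],
the inequality [\int w <= 1].

The negative part of the entropy may have an infinite integral.  Gibbs'
inequality is therefore used in its pointwise form
[v ln (1/v) <= - v ln w + w - v]; with [- ln w] replaced by its upper bound from
concavity the right-hand side is integrable, which bounds the positive part of
the entropy, and monotonicity of the extended integral does the rest
([gibbs_inequality]).  In dimension [0] the
group is a point, [Q = 0], [v = 1] and both sides vanish. *)

(** * Integrals over measure spaces *)

Lemma integral_gt0 d (T : measurableType d) (R : realType)
    (m : {measure set T -> \bar R}) (D : set T) (f : T -> \bar R) :
  measurable D -> measurable_fun D f -> (forall x, D x -> 0 < f x)%E ->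
  (m D != 0)%E -> (0 < \int[m]_(x in D) f x)%E.
Proof.
move=> mD mf f0; apply: contraNT; rewrite -leNgt => If.
have : (\int[m]_(x in D) `|f x| = 0)%E.
  apply/le_anti/andP; split; last exact: integral_ge0.
  rewrite (le_trans _ If)// le_eqVlt; apply/orP; left; apply/eqP.
  by apply: eq_integral => x; rewrite inE => /f0/ltW; exact: gee0_abs.
move/(ae_eq_integral_abs m mD mf) => [A [mA mA0 sA]].
apply/eqP; apply: (subset_measure0 mD mA _ mA0) => x Dx; apply: sA => /=.
by move=> /(_ Dx) /= fx0; move: (f0 _ Dx); rewrite fx0 ltxx.
Qed.

Lemma ge0_fubini_tonelli_in d1 d2 (T1 : measurableType d1)
    (T2 : measurableType d2) (R : realType)
    (m1 : {sigma_finite_measure set T1 -> \bar R})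
    (m2 : {sigma_finite_measure set T2 -> \bar R})
    (A : set T1) (B : set T2) (f : T1 * T2 -> \bar R) :
  measurable A -> measurable B -> measurable_fun (A `*` B) f ->
  (forall x y, A x -> B y -> 0 <= f (x, y))%E ->
  (\int[m1]_(x in A) \int[m2]_(y in B) f (x, y) =
   \int[m2]_(y in B) \int[m1]_(x in A) f (x, y))%E.
Proof.
move=> mA mB mf f0; pose g := f \_ (A `*` B).
have g0 z : (0 <= g z)%E.
  by apply: erestrict_ge0 => -[x y] [/= Ax By]; exact: f0.
have mg : measurable_fun setT g.
  by apply/(measurable_restrictT f) => //; exact: measurableX.
transitivity (\int[m1]_x \int[m2]_y g (x, y))%E.
  rewrite integral_mkcond; apply: eq_integral => x _; rewrite patchE.
  case: ifPn => [|/negP]; rewrite inE => Ax.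
    rewrite integral_mkcond; apply: eq_integral => y _; rewrite /g !patchE.
    by rewrite in_setX (mem_set Ax).
  rewrite integral0_eq// => y _; rewrite /g patchE in_setX.
  by case: ifPn => // /andP[]; rewrite inE.
rewrite (fubini_tonelli g)//; apply/esym.
rewrite integral_mkcond; apply: eq_integral => y _; rewrite patchE.
case: ifPn => [|/negP]; rewrite inE => By.
  rewrite integral_mkcond; apply: eq_integral => x _; rewrite /g !patchE.
  by rewrite in_setX (mem_set By) andbT.
rewrite integral0_eq// => x _; rewrite /g patchE in_setX.
by case: ifPn => // /andP[_]; rewrite inE.
Qed.

(** * The entropy inequality *)

(** Both the positive and the negative part are monotone, and so is subtraction
in the extended reals, so the comparison extends to infinite integrals; the
entropy integral may be [-oo]. *)
Lemma le_integral_measurable d (T : measurableType d) (R : realType)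
    (m : {measure set T -> \bar R}) (f g : T -> \bar R) :
  measurable_fun setT f -> measurable_fun setT g ->
  (forall x, f x <= g x)%E -> (\int[m]_x f x <= \int[m]_x g x)%E.
Proof.
move=> mf mg fg; rewrite integralE [leRHS]integralE leeB//.
- apply: ge0_le_integral => //; try exact: measurable_funepos.
  by move=> x _; apply: funepos_le => //; rewrite inE.
- apply: ge0_le_integral => //; try exact: measurable_funeneg.
  by move=> x _; apply: funeneg_le => //; rewrite inE.
Qed.

(** This is [ln (w / v) <= w / v - 1] multiplied by [v], arranged so that it
makes sense at [v = 0], where [0^-1 = 0] gives [0 ln (1/0) = 0]. *)
Lemma mul_ln_ratio_le (R : realType) (v w : R) : 0 <= v -> 0 < w ->
  v * ln v^-1 <= v * - ln w + w - v.
Proof.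
rewrite le_eqVlt => /predU1P[<- w0|v0 w0].
  by rewrite !mul0r add0r subr0 ltW.
have wv0 : 0 < w / v by rewrite divr_gt0.
rewrite -addrA -lerBlDl -mulrBr opprK -lnM ?posrE ?invr_gt0//.
have -> : w - v = v * (w / v - 1) by rewrite mulrBr mulr1 mulrC divfK ?gt_eqF.
rewrite ler_pM2l// [v^-1 * w]mulrC.
have := @le_ln1Dx _ (w / v - 1); rewrite [1 + _]addrC subrK; apply.
by rewrite ltrBrDr addNr.
Qed.

(** The upper bound [L] on [- ln w] stands between the entropy and the cross
entropy because [v ln w] need not be integrable a priori, whereas [L] can be
chosen so that [v L] is. *)
Lemma gibbs_inequality d (T : measurableType d) (R : realType)
    (m : {measure set T -> \bar R}) (v w L : T -> R) (A : R) :
  measurable_fun setT v -> measurable_fun setT w ->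
  (forall x, 0 <= v x) -> (forall x, 0 < w x) ->
  (\int[m]_x (v x)%:E = 1)%E -> (\int[m]_x (w x)%:E <= 1)%E ->
  m.-integrable setT (fun x => (v x * L x)%:E) ->
  (\int[m]_x (v x * L x)%:E = A%:E)%E ->
  (forall x, - ln (w x) <= L x) ->
  let h x := v x * ln (v x)^-1 in
  (\int[m]_x (Num.max (h x) 0)%:E < +oo)%E /\ (\int[m]_x (h x)%:E <= A%:E)%E.
Proof.
move=> mv mw v0 w0 intv intw ivL iA wL h.
have iv : m.-integrable setT (EFin \o v).
  apply/integrableP; split; first exact/measurable_EFinP.
  rewrite (eq_integral (EFin \o v)) ?intv ?ltry// => x _.
  by rewrite gee0_abs// lee_fin.
have iw : m.-integrable setT (EFin \o w).
  apply/integrableP; split; first exact/measurable_EFinP.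
  rewrite (eq_integral (EFin \o w)) ?(le_lt_trans intw) ?ltry// => x _.
  by rewrite gee0_abs// lee_fin ltW.
pose g := ((fun x => (v x * L x)%:E) \+ (EFin \o w) \- (EFin \o v))%E.
have ig : m.-integrable setT g by apply: integrableB => //; exact: integrableD.
have mg : measurable_fun setT g by case/integrableP : ig.
have hg x : ((h x)%:E <= g x)%E.
  have -> : g x = (v x * L x + w x - v x)%:E by [].
  rewrite lee_fin (le_trans (mul_ln_ratio_le (v0 x) (w0 x)))//.
  by rewrite !lerD2r ler_wpM2l.
have mh : measurable_fun setT h.
  have -> : h = fun x => v x * - ln (v x).
    apply/funext => x; rewrite /h; have := v0 x.
    by rewrite le_eqVlt => /predU1P[<-|vx]; rewrite ?mul0r// lnV ?posrE.
  apply: measurable_funM => //; apply: measurableT_comp => //.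
  exact: measurableT_comp (@measurable_ln R) mv.
have mhE : measurable_fun setT (EFin \o h) by exact/measurable_EFinP.
split.
  case/integrableP : ig => _; apply: le_lt_trans; apply: ge0_le_integral => //.
  - by move=> x _; rewrite lee_fin le_max lexx orbT.
  - by apply/measurable_EFinP; exact: measurable_maxr.
  - exact: measurableT_comp.
  - move=> x _; have [_|_] := leP (h x) 0; first exact: abse_ge0.
    exact: le_trans (hg x) (lee_abs _).
apply: (@le_trans _ _ (\int[m]_x g x)%E); first exact: le_integral_measurable.
rewrite integralB//; last exact: integrableD.
by rewrite integralD// iA intv leeBlDr// leeD2l.
Qed.

Lemma ln_le_tangent (R : realType) (a b : R) : 0 < a -> 0 < b ->
  ln b <= ln a + (b - a) / a.
Proof.
move=> a0 b0; have ba : 0 < b / a by rewrite divr_gt0.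
rewrite -lerBlDl -ln_div ?posrE// mulrBl divff ?gt_eqF//.
have := @le_ln1Dx _ (b / a - 1); rewrite [1 + _]addrC subrK; apply.
by rewrite ltrBrDr addNr.
Qed.

(** At the minimizing [s] one has [s M = 1 / (alpha - 1)], hence
[1 + s M = alpha / (alpha - 1)]; the factor
[alpha^alpha (alpha - 1)^(1 - alpha)] of the sharp constant is what remains
of these two logarithms. *)
Lemma optimal_dilation_value (R : realType) (Q alpha I M : R) :
  0 < Q -> 1 < alpha -> 0 < I -> 0 < M ->
  let s := ((alpha - 1) * M)^-1 in
  ln I - Q / alpha * ln s + Q * ln (1 + s * M) =
  Q / alpha *
    ln (alpha `^ alpha * (alpha - 1) `^ (1 - alpha) * I `^ (alpha / Q) * M).
Proof.
move=> Q0 al1 I0 M0 s.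
have al0 : 0 < alpha by exact: lt_trans al1.
have a10 : 0 < alpha - 1 by rewrite subr_gt0.
have -> : 1 + s * M = alpha / (alpha - 1).
  by rewrite /s; field; rewrite !gt_eqF.
rewrite /s lnV ?posrE ?mulr_gt0// ln_div ?posrE//.
rewrite !lnM ?posrE ?mulr_gt0 ?powR_gt0// !ln_powR.
by field; rewrite !gt_eqF.
Qed.

(** An affine function of [rho] centred at the [v]-mean of [rho] integrates to
its constant term: the tangent line of the logarithm at the mean costs
nothing. *)
Lemma integral_affine_mean d (T : measurableType d) (R : realType)
    (m : {measure set T -> \bar R}) (v rho : T -> R) (A c M : R) :
  m.-integrable setT (EFin \o v) ->
  m.-integrable setT (fun x => (rho x * v x)%:E) ->
  (\int[m]_x (v x)%:E = 1)%E -> (\int[m]_x (rho x * v x)%:E = M%:E)%E ->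
  let f x := v x * (A + c * (rho x - M)) in
  m.-integrable setT (EFin \o f) /\ (\int[m]_x (f x)%:E = A%:E)%E.
Proof.
move=> iv irv Iv Irv f.
have fE : EFin \o f =
    ((fun x => (A - c * M)%:E * (v x)%:E) \+
     (fun x => c%:E * (rho x * v x)%:E))%E.
  by apply/funext => x; rewrite /= -!EFinM -EFinD; congr (_%:E); rewrite /f; ring.
have i1 := integrableZl measurableT (A - c * M) iv.
have i2 := integrableZl measurableT c irv.
split; first by rewrite fE; exact: integrableD.
rewrite (_ : (fun x => _) = EFin \o f)// fE integralD//.
rewrite integralZl// Iv integralZl// Irv mule1 -EFinM -EFinD.
by rewrite subrK.
Qed.

(** * Substitution on the half-line *)

Section half_line.
Context {R : realType}.
Local Notation mu := (@lebesgue_measure R).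
Local Notation pos := (`]0%R, +oo[%classic : set R).

Lemma continuous_pos_measurable (f : R -> R) :
  (forall x : R, 0 < x -> {for x, continuous f}) -> measurable_fun pos f.
Proof.
move=> cf; apply: open_continuous_measurable_fun; first exact: interval_open.
by move=> x; rewrite inE/= in_itv/= andbT; exact: cf.
Qed.

(** The images under an increasing bijection of the half-line of the compact
intervals [[1/n, n]] exhaust it, so that integrals over compact intervals,
away from a possible singularity at [0], determine the improper integral. *)
Lemma itvcc_exhaust_pos (F : R -> R) (f : R -> \bar R) :
  {in pos &, {homo F : x y / x < y}} -> (forall x : R, 0 < x -> 0 < F x) ->
  (forall y : R, 0 < y -> exists2 x, 0 < x & F x = y) ->
  measurable_fun pos f -> (forall x : R, 0 < x -> (0 <= f x)%E) ->
  (\int[mu]_(x in `[F n.+1%:R^-1%R, F n.+1%:R%R]) f x @[n --> \oo] -->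
    \int[mu]_(x in pos) f x)%E.
Proof.
move=> incF F0 surjF mf f0.
have wF x y : 0 < x -> x <= y -> F x <= F y.
  move=> x0; rewrite le_eqVlt => /predU1P[->//|xy]; apply/ltW/incF => //.
    by rewrite inE/= in_itv/= x0.
  by rewrite inE/= in_itv/= (lt_trans x0).
have n0 n : (0 : R) < n.+1%:R^-1 by rewrite invr_gt0.
have sub n : `[F n.+1%:R^-1, F n.+1%:R] `<=` pos.
  move=> x /=; rewrite !in_itv/= andbT => /andP[+ _].
  by apply: lt_le_trans; exact: F0.
rewrite [X in (_ --> \int[_]_(x in X) _)%E](_ : _ =
    \bigcup_n `[F n.+1%:R^-1, F n.+1%:R]%classic).
  apply: ge0_nondecreasing_set_cvg_integral => //.
  - apply/nondecreasing_seqP => n; apply/subsetPset => x /=.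
    rewrite !in_itv/= => /andP[a b]; apply/andP; split.
      by apply: le_trans a; apply: wF => //; rewrite lef_pV2 ?posrE// ler_nat.
    by apply: (le_trans b); apply: wF; rewrite // ler_nat.
  - by move=> n; exact: measurable_funS mf.
  - by move=> n x /sub; rewrite /= in_itv/= andbT; exact: f0.
apply/seteqP; split => [y /=|y [n _]]; last exact: sub.
rewrite in_itv/= andbT => /surjF[x x0 <-].
have [n [nx xn]] : exists n : nat, n.+1%:R^-1 <= x /\ x <= n.+1%:R.
  exists (maxn (Num.truncn x) (Num.truncn x^-1)); split.
    rewrite -[leRHS]invrK lef_pV2 ?posrE ?invr_gt0//.
    apply/ltW/(lt_le_trans (Num.Theory.truncnS_gt _)).
    by rewrite ler_nat ltnS leq_maxr.
  apply/ltW/(lt_le_trans (Num.Theory.truncnS_gt _)).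
  by rewrite ler_nat ltnS leq_maxl.
by exists n => //=; rewrite in_itv/= !wF.
Qed.

(** The formula is taken on compact subintervals and passed to the limit,
because the derivative of a power [x `^ p] may be unbounded at [0] or at
infinity. *)
Lemma ge0_integration_by_substitution_pos (F f G : R -> R) :
  {in pos &, {homo F : x y / x < y}} -> (forall x : R, 0 < x -> 0 < F x) ->
  (forall y : R, 0 < y -> exists2 x, 0 < x & F x = y) ->
  (forall x : R, 0 < x -> is_derive x 1 F (f x)) ->
  (forall x : R, 0 < x -> {for x, continuous f}) ->
  (forall x : R, 0 < x -> 0 <= f x) ->
  (forall x : R, 0 < x -> {for x, continuous G}) ->
  (forall x : R, 0 < x -> 0 <= G x) ->
  (\int[mu]_(x in pos) (G x)%:E = \int[mu]_(x in pos) (G (F x) * f x)%:E)%E.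
Proof.
move=> incF F0 surjF dF cf f0 cG G0.
have cF (x : R) : 0 < x -> {for x, continuous F}.
  move=> /dF[? _]; exact/differentiable_continuous/derivable1_diffP.
have cGFf (x : R) : 0 < x -> {for x, continuous (fun x => G (F x) * f x)}.
  move=> x0; apply: continuousM; last exact: cf.
  by apply: continuous_comp; [exact: cF|apply: cG; exact: F0].
have lim1 := @itvcc_exhaust_pos F (EFin \o G) incF F0 surjF
  (measurableT_comp (@EFin_measurable _ _) (continuous_pos_measurable cG)) G0.
have lim2 := @itvcc_exhaust_pos id (EFin \o (fun x => G (F x) * f x))
  (fun _ _ _ _ => id) (fun _ => id) (fun y y0 => ex_intro2 _ _ y y0 erefl)
  (measurableT_comp (@EFin_measurable _ _) (continuous_pos_measurable cGFf))
  (fun x x0 => mulr_ge0 (G0 _ (F0 _ x0)) (f0 _ x0)).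
rewrite -(cvg_lim _ lim1)// -(cvg_lim _ lim2)//; congr (limn _).
apply/funext => n.
have n0 : (0 : R) < n.+1%:R^-1 by rewrite invr_gt0.
have n1 : (n.+1%:R^-1 : R) <= n.+1%:R.
  by rewrite (@le_trans _ _ 1)// ?invf_le1// ler1n.
have F'E (x : R) : 0 < x -> F^`()%classic x = f x.
  by move=> /dF ?; rewrite derive1E derive_val.
have cF' (x : R) : 0 < x -> {for x, continuous F^`()%classic}.
  move=> x0; change (F^`()%classic y @[y --> x] --> F^`()%classic x).
  rewrite F'E//; apply: cvg_trans (cf _ x0).
  apply: near_eq_cvg; near=> y; rewrite F'E//; near: y.
  exact: lt_nbhsr.
rewrite integration_by_substitution_increasing//.
- apply: eq_integral => x; rewrite inE/= in_itv/= => /andP[nx _].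
  by rewrite -F'E// (lt_le_trans n0).
- move=> x y; rewrite !in_itv/= => /andP[nx _] /andP[ny _].
  by apply: incF; rewrite inE/= in_itv/= (lt_le_trans n0).
- by move=> x; rewrite in_itv/= => /andP[nx _]; apply/cF'/(lt_trans n0).
- by apply: (cvgP (F^`()%classic n.+1%:R^-1)); apply/cvg_at_right_filter/cF'.
- by apply: (cvgP (F^`()%classic n.+1%:R)); apply/cvg_at_left_filter/cF'.
- split.
  + by move=> x; rewrite in_itv/= => /andP[nx _]; case: (dF x (lt_trans n0 nx)).
  + exact/cvg_at_right_filter/cF.
  + exact/cvg_at_left_filter/cF.
- apply: continuous_in_subspaceT => x; rewrite inE/= in_itv/= => /andP[nx _].
  by apply: cG; rewrite (lt_le_trans _ nx)// F0.
Unshelve. all: end_near. Qed.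

Lemma continuous_powR_pos (p x : R) : 0 < x -> {for x, continuous (@powR R ^~ p)}.
Proof.
move=> x0; apply/differentiable_continuous/derivable1_diffP.
by apply: derivable_powR; rewrite in_itv/= x0.
Qed.

Lemma ge0_integral_powR_substitution (c p : R) (G : R -> R) : 0 < c -> 0 < p ->
  (forall x : R, 0 < x -> {for x, continuous G}) ->
  (forall x : R, 0 < x -> 0 <= G x) ->
  (\int[mu]_(x in pos) (G x)%:E =
   \int[mu]_(x in pos) (G (c * x `^ p) * (c * (p * x `^ (p - 1))))%:E)%E.
Proof.
move=> c0 p0 cG G0.
apply: (@ge0_integration_by_substitution_pos (fun x => c * x `^ p)) => //.
- move=> x y; rewrite !inE/= !in_itv/= !andbT => x0 y0 xy.
  by rewrite ltr_pM2l// gt0_ltr_powR// nnegrE ltW.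
- by move=> x x0; rewrite mulr_gt0// powR_gt0.
- move=> y y0; exists ((y / c) `^ p^-1); first by rewrite powR_gt0 ?divr_gt0.
  rewrite -powRrM mulVf ?gt_eqF// powRr1 ?divr_ge0 ?ltW//.
  by rewrite mulrCA divff ?mulr1// gt_eqF.
- move=> x x0; have H := @is_derive1_powR R p x x0.
  exact: (is_deriveZ c H).
- move=> x x0; apply: continuousM; first exact: cvg_cst.
  by apply: continuousM; [exact: cvg_cst|exact: continuous_powR_pos].
- by move=> x x0; rewrite !mulr_ge0 ?powR_ge0// ltW.
Qed.

(** ** The Gamma function *)

(** The [m]-th power of [t / m <= expR (t / m)]. *)
Lemma powR_expR_le (m t : R) : 0 < m -> 0 <= t -> t `^ m * expR (- t) <= m `^ m.
Proof.
move=> m0 t0; rewrite expRN ler_pdivrMr ?expR_gt0//.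
have -> : expR t = (expR (t / m)) `^ m by rewrite -expRM divfK ?gt_eqF.
rewrite -powRM ?expR_ge0 ?(ltW m0)//; apply: ge0_ler_powR; rewrite ?nnegrE//.
- exact: ltW.
- by rewrite mulr_ge0 ?expR_ge0 ?(ltW m0).
- rewrite -ler_pdivrMl// mulrC.
  by apply: le_trans (expR_ge1Dx _); rewrite lerDr.
Qed.

Lemma continuous_Gamma_integrand (a t : R) : 0 < t ->
  {for t, continuous (fun t : R => t `^ (a - 1) * expR (- t))}.
Proof.
move=> t0; apply: continuousM; first exact: continuous_powR_pos.
by apply: continuous_comp; [exact: continuousN|exact: continuous_expR].
Qed.

Lemma Gamma_integrand_ge0 (a t : R) : 0 <= t `^ (a - 1) * expR (- t).
Proof. by rewrite mulr_ge0 ?powR_ge0 ?expR_ge0. Qed.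

Lemma ge0_integralZl_pos (k : R) (f : R -> R) : 0 <= k -> measurable_fun pos f ->
  (forall x : R, 0 < x -> 0 <= f x) ->
  (\int[mu]_(x in pos) (k * f x)%:E = k%:E * \int[mu]_(x in pos) (f x)%:E)%E.
Proof.
move=> k0 mf f0; under eq_integral do rewrite EFinM.
rewrite ge0_integralZl//; first exact/measurable_EFinP.
by move=> x; rewrite /= in_itv/= andbT lee_fin; exact: f0.
Qed.

(** The substitution [t = x `^ a^-1] removes the singularity of the integrand
at [0] and leaves [a^-1 * expR (- x `^ a^-1)], which is dominated by a
multiple of [1 / (1 + x ^+ 2)]. *)
Lemma Gamma_integral_lty (a : R) : 0 < a ->
  (\int[mu]_(t in pos) (t `^ (a - 1) * expR (- t))%:E < +oo)%E.
Proof.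
move=> a0; have ai0 : 0 < a^-1 by rewrite invr_gt0.
rewrite (ge0_integral_powR_substitution (c := 1) (p := a^-1))//; last 2 first.
- exact: continuous_Gamma_integrand.
- by move=> *; exact: Gamma_integrand_ge0.
(* With this exponent, [(x `^ a^-1) `^ m] is [x ^+ 2]. *)
pose m := 2 * a; have m0 : 0 < m by rewrite mulr_gt0.
pose K := a^-1 * (1 + m `^ m).
have K0 : 0 <= K by rewrite mulr_ge0 ?(ltW ai0)// addr_ge0 ?powR_ge0.
have moD : measurable_fun pos (fun x : R => (oneDsqr x)^-1).
  by apply: continuous_pos_measurable => x _; exact: continuous_oneDsqrV.
apply: (@le_lt_trans _ _ (\int[mu]_(x in pos) (K * (oneDsqr x)^-1)%:E)%E).
  apply: ge0_le_integral => //=.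
  - move=> x; rewrite in_itv/= andbT => x0; rewrite lee_fin mulr_ge0//.
      exact: Gamma_integrand_ge0.
    by rewrite !mulr_ge0 ?powR_ge0// ltW.
  - apply/measurable_EFinP; apply: continuous_pos_measurable => x x0.
    apply: continuousM; last first.
      apply: continuousM; first exact: cvg_cst.
      by apply: continuousM; [exact: cvg_cst|exact: continuous_powR_pos].
    apply: (@continuous_comp _ _ _ (fun x => 1 * x `^ a^-1)
      (fun t => t `^ (a - 1) * expR (- t))).
      by apply: continuousM; [exact: cvg_cst|exact: continuous_powR_pos].
    by apply: continuous_Gamma_integrand; rewrite mul1r powR_gt0.
  - by apply/measurable_EFinP; exact: measurable_funM.
  - move=> x; rewrite in_itv/= andbT => x0; rewrite lee_fin !mul1r.
    have -> : (x `^ a^-1) `^ (a - 1) * expR (- x `^ a^-1) *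
        (a^-1 * x `^ (a^-1 - 1)) = a^-1 * expR (- x `^ a^-1).
      rewrite -powRrM mulrBr mulVf ?gt_eqF// mulr1 [a^-1 * _]mulrC mulrACA.
      rewrite -powRD; last by rewrite (gt_eqF x0) implybT.
      by rewrite addrA subrK subrr powRr0 mul1r mulrC.
    rewrite /K -mulrA ler_pM2l// ler_pdivlMr; last first.
      by rewrite (lt_le_trans ltr01)// oneDsqr_ge1.
    rewrite /oneDsqr mulrDr mulr1 lerD//.
      by rewrite -expR0 ler_expR oppr_le0 powR_ge0.
    have := powR_expR_le m0 (powR_ge0 x a^-1).
    by rewrite -powRrM /m mulrCA mulVf ?gt_eqF// mulr1 powR_mulrn ?(ltW x0)// mulrC.
rewrite ge0_integralZl_pos//.
rewrite integral_itv_obnd_cbnd; last exact/measurable_EFinP.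
by rewrite integral0y_oneDsqr -EFinM ltry.
Qed.

Lemma GammaE (a : R) : 0 < a ->
  (Gamma a)%:E = (\int[mu]_(t in pos) (t `^ (a - 1) * expR (- t))%:E)%E.
Proof.
move=> a0; rewrite /Gamma /Rintegral fineK// ge0_fin_numE ?Gamma_integral_lty//.
by apply: integral_ge0 => x _; rewrite lee_fin Gamma_integrand_ge0.
Qed.

Lemma Gamma_gt0 (a : R) : 0 < a -> 0 < Gamma a.
Proof.
move=> a0; rewrite -lte_fin GammaE//; apply: integral_gt0 => //.
- by apply/measurable_EFinP; apply: continuous_pos_measurable => x;
    exact: continuous_Gamma_integrand.
- move=> x; rewrite /= in_itv/= andbT => x0.
  by rewrite lte_fin mulr_gt0 ?powR_gt0 ?expR_gt0.
- by have := lebesgue_measure_itv (`]0%R, +oo[ : interval R);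
    rewrite /= ltry => ->.
Qed.

Lemma ge0_integral_scale (c : R) (G : R -> R) : 0 < c ->
  (forall x : R, 0 < x -> {for x, continuous G}) ->
  (forall x : R, 0 < x -> 0 <= G x) ->
  (\int[mu]_(x in pos) (G x)%:E = \int[mu]_(x in pos) (G (c * x) * c)%:E)%E.
Proof.
move=> c0 cG G0; rewrite (ge0_integral_powR_substitution c0 ltr01 cG G0).
apply: eq_integral => x; rewrite inE/= in_itv/= andbT => x0.
by rewrite subrr powRr0 !mulr1 powRr1// ltW.
Qed.

Lemma powR_expR_ln (x p : R) : 0 < x -> x `^ p = expR (p * ln x).
Proof. by move=> x0; rewrite /powR gt_eqF. Qed.

(** Euler's argument: in [Gamma a * Gamma b], written as a double integral over
[s] and [t], substitute [t = s * x], exchange the integrals, and recognize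
[Gamma (a + b)] in the integral over [s] after rescaling by [1 + x]. *)
Lemma Gamma_mul_beta (a b : R) : 0 < a -> 0 < b ->
  ((Gamma a * Gamma b)%:E = (Gamma (a + b))%:E *
    \int[mu]_(x in pos) (x `^ (b - 1) * (1 + x) `^ (- (a + b)))%:E)%E.
Proof.
move=> a0 b0; have ab0 : 0 < a + b by exact: addr_gt0.
pose g (c t : R) := t `^ (c - 1) * expR (- t).
have cg c t : 0 < t -> {for t, continuous (g c)}.
  exact: continuous_Gamma_integrand.
have g0 c t : 0 <= g c t by exact: Gamma_integrand_ge0.
have mg c : measurable_fun setT (g c).
  apply: measurable_funM; first exact: measurable_powR.
  by apply: measurableT_comp => //; exact: measurable_expR.
have mgpos c : measurable_fun pos (g c) by exact: measurable_funS (mg c).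
pose f (p : R * R) := (g a p.1 * (g b (p.1 * p.2) * p.1))%:E.
transitivity (\int[mu]_(s in pos) \int[mu]_(x in pos) f (s, x))%E.
  rewrite mulrC EFinM (GammaE a0) -ge0_integralZl//; last 3 first.
  - by apply/measurable_EFinP; exact: mgpos.
  - by move=> x _; rewrite lee_fin; exact: g0.
  - by rewrite lee_fin ltW// Gamma_gt0.
  apply: eq_integral => s; rewrite inE/= in_itv/= andbT => s0.
  rewrite GammaE// (ge0_integral_scale s0 (cg b) (fun t _ => g0 b t)).
  rewrite muleC -ge0_integralZl//.
  - apply/measurable_EFinP; apply: measurable_funM => //.
    apply: measurableT_comp (mg b) _. exact: measurable_funM.
  - by move=> x _; rewrite lee_fin mulr_ge0// ltW.
  - by rewrite lee_fin; exact: g0.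
have mf : measurable_fun setT f.
  apply/measurable_EFinP; apply: measurable_funM.
    exact: measurableT_comp (mg a) measurable_fst.
  apply: measurable_funM => //.
  by apply: measurableT_comp (mg b) _; exact: measurable_funM.
transitivity (\int[mu]_(x in pos) \int[mu]_(s in pos) f (s, x))%E.
  apply: ge0_fubini_tonelli_in => //; first exact: measurable_funS mf.
  move=> x y; rewrite /= !in_itv/= !andbT => x0 _.
  by rewrite lee_fin; apply: mulr_ge0 => //; rewrite mulr_ge0// ltW.
rewrite GammaE// -ge0_integralZl//; last 3 first.
- apply/measurable_EFinP; apply: measurable_funM.
    by apply: measurable_funS (@measurable_powR R (b - 1)).
  apply: measurable_funS (_ : measurable_fun setT _) => //.
  apply: measurableT_comp (@measurable_powR R (- (a + b))) _.
  exact: measurable_funD.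
- by move=> x _; rewrite lee_fin mulr_ge0 ?powR_ge0.
- by apply: integral_ge0 => x _; rewrite lee_fin; exact: g0.
apply: eq_integral => x; rewrite inE/= in_itv/= andbT => x0.
have x10 : 0 < 1 + x by rewrite addr_gt0.
rewrite (ge0_integral_scale x10 (cg _) (fun t _ => g0 (a + b) t)).
rewrite muleC -ge0_integralZl//; last 3 first.
- apply/measurable_EFinP; apply: measurable_funM => //.
  apply: measurable_funS (_ : measurable_fun setT _) => //.
  by apply: measurableT_comp (mg _) _; exact: measurable_funM.
- by move=> s _; rewrite lee_fin mulr_ge0// ltW.
- by rewrite lee_fin mulr_ge0 ?powR_ge0.
apply: eq_integral => s; rewrite inE/= in_itv/= andbT => s0.
rewrite /f/= -EFinM; congr (_%:E); rewrite /g.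
rewrite !powR_expR_ln ?mulr_gt0// !lnM ?posrE//.
(* The bare factors [s] and [1 + x] of the two Jacobians are turned into
   exponentials as well, so that only the exponents have to be compared. *)
have expln A B y : 0 < y -> A * (B * y) = A * (B * expR (ln y)) :> R.
  by move=> y0; rewrite lnK.
by rewrite [LHS]expln// [RHS]expln// -!expRD; congr expR; ring.
Qed.
(** The substitution [t = s * r `^ alpha] reduces this to the Beta integral with
parameters [Q / alpha] and [Q / alpha'], whose sum is [Q] because the exponents
are conjugate.  The factor [s `^ (Q / alpha)] makes the value independent of
[s]. *)
Lemma integral_radial_profile (Q alpha alpha' s : R) :
  0 < Q -> 1 < alpha -> alpha^-1 + alpha'^-1 = 1 -> 0 < s ->
  (\int[mu]_(r in pos)
     (s `^ (Q / alpha) * (1 + s * r `^ alpha) `^ (- Q) * r `^ (Q - 1))%:E =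
   (Gamma (Q / alpha) * Gamma (Q / alpha') / (alpha * Gamma Q))%:E)%E.
Proof.
move=> Q0 alpha1 conj s0; have alpha0 : 0 < alpha by exact: lt_trans alpha1.
pose a := Q / alpha'; pose b := Q / alpha.
have abQ : a + b = Q by rewrite -mulrDr addrC conj mulr1.
have b0 : 0 < b by rewrite divr_gt0.
have a0 : 0 < a.
  rewrite /a mulr_gt0// -[alpha'^-1](addKr alpha^-1) conj addrC subr_gt0.
  by rewrite invf_lt1.
pose G (x : R) := x `^ (b - 1) * (1 + x) `^ (- (a + b)).
pose k (r : R) := s `^ b * (1 + s * r `^ alpha) `^ (- Q) * r `^ (Q - 1).
have cG (x : R) : 0 < x -> {for x, continuous G}.
  move=> x0; apply: continuousM; first exact: continuous_powR_pos.
  apply: (@continuous_comp R R R (fun x : R => 1 + x) (@powR R ^~ (- (a + b)))).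
    by apply: continuousD; [exact: cvg_cst|exact: cvg_id].
  by apply: continuous_powR_pos; rewrite addr_gt0.
have G0 (x : R) : 0 < x -> 0 <= G x by rewrite mulr_ge0 ?powR_ge0.
have mk : measurable_fun pos k.
  apply: measurable_funS (_ : measurable_fun setT _) => //.
  apply: measurable_funM; last exact: measurable_powR.
  apply: measurable_funM => //; apply: measurableT_comp (measurable_powR _) _.
  by apply: measurable_funD => //; exact: measurable_funM.
have k0 (r : R) : 0 < r -> 0 <= k r by move=> _; rewrite !mulr_ge0 ?powR_ge0.
have := Gamma_mul_beta a0 b0.
rewrite (ge0_integral_powR_substitution s0 alpha0 cG G0) abQ.
rewrite (_ : (\int[mu]_(x in _) _)%E = (\int[mu]_(x in pos) (alpha * k x)%:E)%E).
  rewrite ge0_integralZl_pos ?(ltW alpha0)// muleA -EFinM => E.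
  have gQ0 : 0 < alpha * Gamma Q by rewrite mulr_gt0 ?Gamma_gt0.
  rewrite -/b -/a [Gamma b * _]mulrC [RHS]EFinM E muleAC -EFinM.
  by rewrite [Gamma Q * _]mulrC divff ?gt_eqF// mul1e.
apply: eq_integral => r; rewrite inE/= in_itv/= andbT => r0; congr (_%:E).
have sr0 : 0 < s * r `^ alpha by rewrite mulr_gt0 ?powR_gt0.
have t0 : 0 < 1 + s * r `^ alpha by rewrite addr_gt0.
have bE : b * alpha = Q by rewrite divfK// gt_eqF.
rewrite /G /k abQ; set t := 1 + s * r `^ alpha.
rewrite powRM ?powR_ge0 ?(ltW s0)// -powRrM mulrC [alpha * (b - 1)]mulrBr.
rewrite mulr1 [alpha * b]mulrC bE.
transitivity (alpha * (s `^ (b - 1) * s) * t `^ (- Q) *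
  (r `^ (Q - alpha) * r `^ (alpha - 1))); first by ring.
rewrite -powRD ?(gt_eqF r0) ?implybT// addrA subrK.
by rewrite [s `^ (b - 1) * s]mulrC mulr_powRB1 ?(ltW s0)//; ring.
Qed.

End half_line.

(** * Lebesgue measure on row vectors *)

Lemma lebesgue_rV_setT_neq0 (R : realType) (N : nat) :
  (@lebesgue_rV R N setT != 0)%E.
Proof.
have := @lebesgue_rV_box R N (const_mx 0) (const_mx 1).
rewrite big1 => [|i _]; last by rewrite !mxE subr0.
move=> box1; rewrite gt_eqF//; apply: (@lt_le_trans _ _ 1%E); first exact: lte01.
rewrite -box1; last by move=> i; rewrite !mxE.
by apply: le_measure; rewrite ?inE//; exact: measurable_box_rV.
Qed.

Lemma lebesgue_rV_ae_neq0 (R : realType) (N : nat) : (0 < N)%N ->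
  {ae @lebesgue_rV R N, forall x, x != 0}.
Proof.
case: N => // N _; exists (box_rV 0 0); split.
- exact: measurable_box_rV.
- by rewrite lebesgue_rV_box// big_ord_recl !mxE subr0 mul0r.
- move=> x /= /negP; rewrite negbK => /eqP -> i.
  by rewrite mxE lexx.
Qed.

(** * Quasi-balls and the quasi-sphere *)

Section quasi_norm.
Context {R : realType} {N : nat} (G : homogeneous_group R N).
Context (qn : 'rV[R]_N -> R) (qnP : is_quasi_norm G qn).

(** By compactness of the unit sphere of the sup norm, on which a quasi-norm
does not vanish. *)
Lemma quasi_norm_sphere_lower_bound :
  exists2 m : R, 0 < m & forall y : 'rV[R]_N, `|y| = 1 -> m <= qn y.
Proof.
pose S := [set y : 'rV[R]_N | `|y| = 1].
have [[y0 Sy0]|S0] := pselect (S !=set0); last first.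
  by exists 1 => // y y1; exfalso; apply: S0; exists y.
have cS : compact S.
  apply: bounded_closed_compact.
    exists 1; split; first exact: num_real.
    by move=> x x1 y /= ->; exact: ltW.
  apply: (@closed_comp _ _ (fun y : 'rV[R]_N => `|y|) [set 1]).
    by move=> y _; exact: norm_continuous.
  exact: closed_eq.
have [||c] := @compact_EVT_min _ R qn S _ cS; first by exists y0.
  by apply: continuous_subspaceT; exact: qn_continuous qnP.
rewrite inE => cS1 minc; exists (qn c); last first.
  by move=> y y1; apply: minc; rewrite inE.
rewrite lt_neqAle (qn_ge0 qnP) andbT eq_sym; apply/eqP => /(qn_eq0 qnP) c0.
by move: cS1; rewrite /S/= c0 normr0 => /esym/eqP; rewrite oner_eq0.
Qed.

(** Every nonzero [x] is moved onto the unit sphere of the sup norm by the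
dilation of ratio [1 / t], where [t] is the largest of the
[|x_j| ^ (1 / nu_j)].  Homogeneity and the lower bound on that sphere give
[m <= qn x / t], that is a bound on [t], hence on every coordinate. *)
Lemma quasi_ball_bounded (r : R) :
  exists2 b : R, 0 <= b & forall x, qn x <= r -> forall i, `|x ord0 i| <= b.
Proof.
have [m m0 mP] := quasi_norm_sphere_lower_bound.
pose nu := hg_weight G; have nu0 i : 0 < nu i by exact: hg_weight_gt0.
exists (\sum_(i < N) (r / m) `^ nu i).
  by apply: sumr_ge0 => i _; exact: powR_ge0.
move=> x xr i; have [->|x0] := eqVneq x 0.
  by rewrite mxE normr0; apply: sumr_ge0 => j _; exact: powR_ge0.
pose t j := `|x ord0 j| `^ (nu j)^-1.
have tK j : t j `^ nu j = `|x ord0 j|.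
  by rewrite /t -powRrM mulVf ?gt_eqF// powRr1.
have [k _ kmax'] := @arg_maxP _ _ _ i xpredT t isT.
have kmax j : t j <= t k by exact: kmax'.
have tk0 : 0 < t k.
  rewrite lt_neqAle powR_ge0 andbT eq_sym; apply: contra x0 => /eqP tk.
  apply/eqP/rowP => j; rewrite mxE; apply/eqP; rewrite -normr_eq0 -tK.
  have /le_anti -> : (t j <= 0 <= t j) by rewrite -{1}tk kmax// powR_ge0.
  by rewrite powR_eq0 eqxx gt_eqF.
have lam0 : 0 < (t k)^-1 by rewrite invr_gt0.
pose y := dilation G (t k)^-1 x.
have yE j : `|y ord0 j| = (t j / t k) `^ nu j.
  rewrite mxE normrM (ger0_norm (powR_ge0 _ _)) -tK -powRM ?powR_ge0 ?(ltW lam0)//.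
  by rewrite mulrC.
have y1 : `|y| = 1.
  rewrite [LHS]mx_normrE; apply/le_anti/andP; split.
    apply: bigmax_le => // -[a j] _ /=; rewrite (ord1 a) yE.
    suff: (t j / t k) `^ nu j <= 1 `^ nu j by rewrite powR1.
    apply: ge0_ler_powR; rewrite ?nnegrE ?(ltW (nu0 j))//.
      by rewrite divr_ge0 ?powR_ge0.
    by rewrite ler_pdivrMr// mul1r kmax.
  have := le_bigmax 0 (fun ij : 'I_1 * 'I_N => `|y ij.1 ij.2|) (ord0, k).
  by apply: le_trans; rewrite /= yE divff ?gt_eqF// powR1.
have tkr : t k <= r / m.
  have := mP _ y1; rewrite (qn_dilation qnP)// => my.
  rewrite ler_pdivlMr// mulrC -ler_pdivlMr//.
  by rewrite (le_trans my)// mulrC ler_pM2r.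
rewrite (bigD1 i)//= -tK -[leLHS]addr0 lerD//; last first.
  by apply: sumr_ge0 => j _; exact: powR_ge0.
apply: ge0_ler_powR; rewrite ?nnegrE ?powR_ge0 ?(ltW (nu0 i))//.
  by rewrite (le_trans (powR_ge0 _ _) tkr).
by rewrite (le_trans _ tkr)// kmax.
Qed.

Lemma quasi_ball_sub_box (r : R) : exists2 b : R, 0 <= b &
  [set x | qn x <= r] `<=` box_rV (const_mx (- b)) (const_mx b).
Proof.
have [b b0 bP] := quasi_ball_bounded r; exists b => // x /bP xb i.
by rewrite !mxE -ler_norml.
Qed.

Lemma closed_quasi_sphere : closed (quasi_sphere qn).
Proof.
apply: (@closed_comp _ _ qn [set 1]) => [x _|]; last exact: closed_eq.
exact: qn_continuous qnP x.
Qed.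

Lemma compact_quasi_sphere : compact (quasi_sphere qn).
Proof.
have [b b0 bP] := quasi_ball_bounded 1.
apply: bounded_closed_compact closed_quasi_sphere.
exists b; split; first exact: num_real.
move=> c bc x; rewrite /quasi_sphere/= => x1.
rewrite [leLHS]mx_normrE; apply: bigmax_le => [|[a j] _ /=].
  exact: le_trans (ltW bc).
by rewrite (ord1 a) (le_trans _ (ltW bc))// bP// x1.
Qed.

Lemma measurable_quasi_norm : measurable_fun [set: 'rV[R]_N] qn.
Proof. apply: continuous_measurable_rV; exact: qn_continuous qnP. Qed.

Lemma measurable_quasi_sphere : measurable (quasi_sphere qn).
Proof.
rewrite -[quasi_sphere qn]setTI.
exact: measurable_quasi_norm measurableT _ (measurable_set1 1).
Qed.

Lemma quasi_norm_dilation_sphere (r : R) y : 0 < r -> quasi_sphere qn y ->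
  qn (dilation G r y) = r.
Proof. by move=> r0 y1; rewrite (qn_dilation qnP)// y1 mulr1. Qed.

(** ** Integration of radial functions *)

Context (sigma : {measure set 'rV[R]_N -> \bar R}).
Context (sigmaP : is_polar_measure G qn sigma).
Local Notation S := (quasi_sphere qn).
Local Notation Q := (hom_dim G).
Local Notation mu := (@lebesgue_measure R).
Local Notation leb := (lebesgue_rV N).
Local Notation pos := (`]0%R, +oo[%classic : set R).

Lemma quasi_sphere_measure_fin_num : sigma S \is a fin_num.
Proof.
have [[sfin _] _] := sigmaP.
by rewrite ge0_fin_numE ?measure_ge0// sfin//; exact: compact_quasi_sphere.
Qed.

Lemma measurable_quasi_ball (r : R) : measurable [set x | qn x <= r].
Proof.
rewrite (_ : [set x | _] = qn @^-1` `]-oo, r]); last first.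
  by apply/seteqP; split => x /=; rewrite in_itv.
by rewrite -[X in measurable X]setTI; exact: measurable_quasi_norm.
Qed.

Lemma quasi_ball_measure_lty (r : R) : (leb [set x | (qn x <= r)%R] < +oo)%E.
Proof.
have [b b0 sub] := quasi_ball_sub_box r.
apply: (@le_lt_trans _ _ (leb (box_rV (const_mx (- b)) (const_mx b)))).
  apply: le_measure => //; rewrite inE; first exact: measurable_quasi_ball.
  exact: measurable_box_rV.
rewrite lebesgue_rV_box ?ltry// => i; rewrite !mxE.
by rewrite (@le_trans _ _ 0)// oppr_le0.
Qed.

(** The polar formula applied to [g \o qn] cut off outside a quasi-ball, which is
integrable because [g] is bounded and quasi-balls have finite measure. *)
Lemma radial_integral_quasi_ball (g : R -> R) (K : R) (n : R) :
  measurable_fun setT g -> (forall r, 0 <= g r <= K) ->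
  (\int[leb]_(x in [set x | (qn x <= n)%R]) (g (qn x))%:E <=
   sigma S * \int[mu]_(r in pos) (g r * r `^ (Q - 1))%:E)%E.
Proof.
move=> mg g0K; have g0 r : 0 <= g r by case/andP: (g0K r).
have gK r : g r <= K by case/andP: (g0K r).
have K0 : 0 <= K by exact: le_trans (g0 0) (gK 0).
pose gn (r : R) := g r * \1_(`]-oo, n]) r.
have mgn : measurable_fun setT gn by exact: measurable_funM.
have gn0 r : 0 <= gn r by rewrite mulr_ge0// indicE ler0n.
have gng r : gn r <= g r.
  by rewrite /gn indicE; case: (_ \in _); rewrite /= ?mulr1 ?mulr0.
have mqn := measurable_quasi_norm.
have mball := measurable_quasi_ball n.
have E : (EFin \o (g \o qn)) \_ [set x | qn x <= n] = EFin \o (gn \o qn).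
  apply/funext => x; rewrite patchE /= /gn indicE.
  have [xn|xn] := leP (qn x) n.
    by rewrite !mem_set ?mulr1//= in_itv.
  by rewrite !memNset ?mulr0//= ?in_itv /= leNgt xn.
have int : leb.-integrable setT (EFin \o (gn \o qn)).
  apply/integrableP; split.
    by apply/measurable_EFinP; exact: measurableT_comp.
  rewrite (eq_integral (EFin \o (gn \o qn))); last first.
    by move=> x _; rewrite gee0_abs// lee_fin; exact: gn0.
  rewrite -E -integral_mkcond.
  apply: (@le_lt_trans _ _ (\int[leb]_(x in [set x | (qn x <= n)%R]) K%:E)%E).
    apply: ge0_le_integral => //=.
    - by move=> x _; rewrite lee_fin; case/andP: (g0K (qn x)).
    - apply/measurable_EFinP.
      by apply: measurable_funS (measurableT_comp mg mqn).
    - by move=> x _; rewrite lee_fin; case/andP: (g0K (qn x)).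
  by rewrite integral_cst//= lte_mul_pinfty ?lee_fin// quasi_ball_measure_lty.
rewrite integral_mkcond E (sigmaP.2 _ int).
have mr : measurable_fun pos (fun r : R => r `^ (Q - 1)).
  exact: measurable_funS (measurable_powR _).
rewrite [leLHS](_ : _ =
    \int[mu]_(r in pos) ((gn r * r `^ (Q - 1))%:E * sigma S))%E; last first.
  apply: eq_integral => r; rewrite inE/= in_itv/= andbT => r0.
  rewrite -integral_cst; last exact: measurable_quasi_sphere.
  apply: eq_integral => y; rewrite inE => Sy.
  by rewrite /= quasi_norm_dilation_sphere.
rewrite ge0_integralZr//; last 2 first.
- apply/measurable_EFinP; apply: measurable_funM => //.
  exact: measurable_funS mgn.
- by move=> r _; rewrite lee_fin mulr_ge0 ?powR_ge0 ?gn0.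
rewrite muleC lee_wpmul2l// ge0_le_integral//.
- by move=> r _; rewrite lee_fin mulr_ge0 ?powR_ge0 ?gn0.
- apply/measurable_EFinP; apply: measurable_funM => //.
  exact: measurable_funS mgn.
- apply/measurable_EFinP; apply: measurable_funM => //.
  exact: measurable_funS mg.
- by move=> r _; rewrite lee_fin ler_wpM2r ?powR_ge0.
Qed.

Lemma radial_integral_le (g : R -> R) (K : R) :
  measurable_fun setT g -> (forall r, 0 <= g r <= K) ->
  (\int[leb]_x (g (qn x))%:E <=
   sigma S * \int[mu]_(r in pos) (g r * r `^ (Q - 1))%:E)%E.
Proof.
move=> mg g0K; have g0 r : 0 <= g r by case/andP: (g0K r).
pose F (n : nat) := [set x | qn x <= n%:R].
have <- : \bigcup_n F n = setT.
  apply/seteqP; split => // x _; exists (Num.truncn (qn x)).+1 => //.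
  exact/ltW/Num.Theory.truncnS_gt.
have lim : ((\int[leb]_(x in F n) (g (qn x))%:E) @[n --> \oo] -->
    \int[leb]_(x in \bigcup_n F n) (g (qn x))%:E)%E.
  apply: ge0_nondecreasing_set_cvg_integral => //.
  - apply/nondecreasing_seqP => n; apply/subsetPset => x; rewrite /F/= => xn.
    by rewrite (le_trans xn)// ler_nat.
  - by move=> n; exact: measurable_quasi_ball.
  - move=> n; apply/measurable_EFinP.
    by apply: measurable_funS (measurableT_comp mg measurable_quasi_norm).
  - by move=> n x _; rewrite lee_fin.
rewrite -(cvg_lim _ lim)//; apply: lime_le; first exact: cvgP lim.
by apply: nearW => n; exact: radial_integral_quasi_ball g0K.
Qed.

Lemma hom_dim_gt0 : (0 < N)%N -> 0 < Q.
Proof.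
move=> N0; rewrite /hom_dim (bigD1 (Ordinal N0))//=.
apply: ltr_wpDr; last exact: hg_weight_gt0.
by apply: sumr_ge0 => i _; exact/ltW/hg_weight_gt0.
Qed.

Lemma radial_weight_integral_le (alpha alpha' s : R) : (0 < N)%N ->
  1 < alpha -> alpha^-1 + alpha'^-1 = 1 -> 0 < s ->
  (\int[leb]_x (s `^ (Q / alpha) * (1 + s * qn x `^ alpha) `^ (- Q))%:E <=
   (fine (sigma S) * Gamma (Q / alpha) * Gamma (Q / alpha') /
     (alpha * Gamma Q))%:E)%E.
Proof.
move=> /hom_dim_gt0 Q0 alpha1 conj s0.
pose g (r : R) := s `^ (Q / alpha) * (1 + s * r `^ alpha) `^ (- Q).
have mg : measurable_fun setT g.
  apply: measurable_funM => //; apply: measurableT_comp (measurable_powR _) _.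
  by apply: measurable_funD => //; exact: measurable_funM.
have gK r : 0 <= g r <= s `^ (Q / alpha).
  rewrite mulr_ge0 ?powR_ge0//= ler_piMr ?powR_ge0//.
  rewrite -[leRHS](powRr0 (1 + s * r `^ alpha)) ler_powR ?oppr_le0 ?(ltW Q0)//.
  by rewrite lerDl mulr_ge0 ?powR_ge0 ?(ltW s0).
apply: (le_trans (radial_integral_le mg gK)).
rewrite (integral_radial_profile Q0 alpha1 conj s0).
by rewrite -(fineK quasi_sphere_measure_fin_num) -EFinM !mulrA lexx.
Qed.

End quasi_norm.

(** * Weighted norms of complex-valued functions *)

Section weighted_modulus.
Context {R : realType} {N : nat}.
Implicit Types (u : 'rV[R]_N -> R[i]) (c : 'rV[R]_N -> R).
Local Notation leb := (lebesgue_rV N).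

Lemma cmodulus_ge0 u x : 0 <= cmodulus u x.
Proof. by rewrite /cmodulus; case: (u x) => a b; exact: sqrtr_ge0. Qed.

Lemma cmodulus_scale c u x : 0 <= c x ->
  cmodulus (fun x => (c x)%:C%C * u x) x = c x * cmodulus u x.
Proof.
move=> c0; rewrite /cmodulus Normc.normcM; congr (_ * _).
by rewrite /Normc.normc /= expr0n addr0 sqrtr_sqr ger0_norm.
Qed.

Lemma measurable_cmodulus u : cmeasurable u -> measurable_fun setT (cmodulus u).
Proof.
move=> [mre mim]; have -> : cmodulus u =
    fun x => Num.sqrt (complex.Re (u x) ^+ 2 + complex.Im (u x) ^+ 2).
  by apply/funext => x; rewrite /cmodulus; case: (u x).
apply: (measurableT_comp (f := @Num.sqrt R)).
  by apply: continuous_measurable_fun; exact: sqrt_continuous.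
by apply: measurable_funD; exact: measurable_funX.
Qed.

Lemma Lp_norm1E u : Lp_norm 1 u = (\int[leb]_x (cmodulus u x)%:E)%E.
Proof.
rewrite /Lp_norm Lnorm1; apply: eq_integral => x _.
by rewrite gee0_abs// lee_fin cmodulus_ge0.
Qed.

Lemma Lp_norm1_scale c u : (forall x, 0 <= c x) ->
  Lp_norm 1 (fun x => (c x)%:C%C * u x) =
  (\int[leb]_x (c x * cmodulus u x)%:E)%E.
Proof.
by move=> c0; rewrite Lp_norm1E; apply: eq_integral => x _; rewrite cmodulus_scale.
Qed.

Lemma integral_modulus_gt0 c u : measurable_fun setT c -> cmeasurable u ->
  (forall x, 0 <= c x) -> {ae leb, forall x, c x != 0} ->
  ~ {ae leb, forall x, u x = 0} ->
  (0 < \int[leb]_x (c x * cmodulus u x)%:E)%E.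
Proof.
move=> mc mu c0 c_neq0 u_neq0; have mm := measurable_cmodulus mu.
have f0 x : (0 <= (c x * cmodulus u x)%:E)%E.
  by rewrite lee_fin mulr_ge0// cmodulus_ge0.
rewrite lt_neqAle integral_ge0 ?andbT//; apply/eqP => I0; apply: u_neq0.
have mf : measurable_fun setT (fun x => (c x * cmodulus u x)%:E).
  by apply/measurable_EFinP; exact: measurable_funM.
have : (\int[leb]_x `|(c x * cmodulus u x)%:E| = 0)%E.
  by rewrite [RHS]I0; apply: eq_integral => x _; rewrite gee0_abs.
move/(ae_eq_integral_abs _ measurableT mf); move: c_neq0.
apply: filterS2 => x cx /(_ I) /= [] /eqP.
by rewrite mulf_eq0 (negbTE cx)/= => /eqP/Normc.eq0_normc.
Qed.

End weighted_modulus.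

(** The bracket dominates both [1] and the quasi-norm, so its weight controls
the unweighted and the homogeneous norm at once. *)
Lemma in_weighted_Lp1_lty (R : realType) (N : nat) (G : homogeneous_group R N)
    (qn : 'rV[R]_N -> R) (alpha : R) (u : 'rV[R]_N -> R[i]) :
  is_quasi_norm G qn -> 0 < alpha -> in_weighted_Lp qn 1 alpha u ->
  (\int[lebesgue_rV N]_x (cmodulus u x)%:E < +oo)%E /\
  (\int[lebesgue_rV N]_x (qn x `^ alpha * cmodulus u x)%:E < +oo)%E.
Proof.
move=> qnP alpha0 [[mu _] [_]].
have jb0 x : 0 <= japanese_bracket qn x `^ alpha by exact: powR_ge0.
rewrite Lp_norm1_scale// => wfin.
have mq := measurable_quasi_norm qnP.
have mn := measurable_cmodulus mu.
have jb1 x : 1 <= japanese_bracket qn x.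
  by rewrite -[leLHS]sqrtr1 ler_wsqrtr// lerDl sqr_ge0.
have jbq x : qn x <= japanese_bracket qn x.
  rewrite -[leLHS]ger0_norm ?(qn_ge0 qnP)// -sqrtr_sqr ler_wsqrtr//.
  by rewrite lerDr.
have mjb : measurable_fun setT (japanese_bracket qn).
  apply: (measurableT_comp (f := @Num.sqrt R)).
    by apply: continuous_measurable_fun; exact: sqrt_continuous.
  by apply: measurable_funD => //; exact: measurable_funX.
have mjn : measurable_fun setT
    (fun x => (japanese_bracket qn x `^ alpha * cmodulus u x)%:E).
  apply/measurable_EFinP; apply: measurable_funM => //.
  exact: measurableT_comp (measurable_powR _) mjb.
split; apply: le_lt_trans wfin; apply: ge0_le_integral => //.
- by move=> x _; rewrite lee_fin cmodulus_ge0.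
- exact/measurable_EFinP.
- move=> x _; rewrite lee_fin ler_peMl ?cmodulus_ge0//.
  by rewrite -(powRr0 (japanese_bracket qn x)) ler_powR// ltW.
- by move=> x _; rewrite lee_fin mulr_ge0 ?powR_ge0 ?cmodulus_ge0.
- apply/measurable_EFinP; apply: measurable_funM => //.
  exact: measurableT_comp (measurable_powR _) mq.
- move=> x _; rewrite lee_fin ler_wpM2r ?cmodulus_ge0//.
  apply: ge0_ler_powR; rewrite ?nnegrE ?(ltW alpha0) ?(qn_ge0 qnP)//.
  by rewrite (le_trans ler01).
Qed.

Theorem corollary3p3 (R : realType) (N : nat) (G : homogeneous_group R N)
    (qn : 'rV[R]_N -> R) (sigma : {measure set 'rV[R]_N -> \bar R})
    (alpha alpha' : R) (u : 'rV[R]_N -> R[i]) :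
  is_quasi_norm G qn ->
  is_polar_measure G qn sigma ->
  1 < alpha ->
  alpha^-1 + alpha'^-1 = 1 ->
  in_weighted_Lp qn 1 alpha u ->
  ~ {ae lebesgue_rV N, forall x, u x = 0} ->
  let Q := hom_dim G in
  let B := B_const Q alpha alpha' (fine (sigma (quasi_sphere qn))) in
  let norm_u := fine (Lp_norm 1 u) in
  let norm_wu := fine (Lp_norm 1 (fun x => (qn x `^ alpha)%:C%C * u x)) in
  let v x := cmodulus u x / norm_u in
  let h x := v x * ln ((v x)^-1) in
  (\int[lebesgue_rV N]_x (Num.max (h x) 0)%:E < +oo)%E /\
  (\int[lebesgue_rV N]_x (h x)%:E
     <= (Q / alpha * ln (B / norm_u * norm_wu))%:E)%E.
Proof.
move=> qnP sigmaP alpha1 conj uw u_neq0 Q B norm_u norm_wu v h.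
have alpha0 : 0 < alpha by exact: lt_trans alpha1.
have mesu : cmeasurable u by case: uw => [[]].
pose n := cmodulus u; pose rho x := qn x `^ alpha.
have n0 x : 0 <= n x by exact: cmodulus_ge0.
have rho0 x : 0 <= rho x by exact: powR_ge0.
have mn : measurable_fun setT n by exact: measurable_cmodulus.
have mrho : measurable_fun setT rho.
  exact: measurableT_comp (measurable_powR _) (measurable_quasi_norm qnP).
have [fin_u fin_wu] := in_weighted_Lp1_lty qnP alpha0 uw.
have norm_uE : (norm_u%:E = \int[lebesgue_rV N]_x (n x)%:E)%E.
  rewrite /norm_u Lp_norm1E fineK// ge0_fin_numE// integral_ge0// => x _.
  by rewrite lee_fin n0.
have norm_wuE : (norm_wu%:E = \int[lebesgue_rV N]_x (rho x * n x)%:E)%E.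
  rewrite /norm_wu Lp_norm1_scale// fineK// ge0_fin_numE// integral_ge0// => x _.
  by rewrite lee_fin mulr_ge0 ?rho0 ?n0.
have norm_u0 : 0 < norm_u.
  rewrite -lte_fin norm_uE.
  have := @integral_modulus_gt0 _ _ (fun=> 1) u (measurable_cst _) mesu
    (fun=> ler01) _ u_neq0.
  under eq_integral do rewrite mul1r.
  by apply; apply: nearW => x; exact: oner_neq0.
have v0 x : 0 <= v x by rewrite divr_ge0 ?(ltW norm_u0) ?n0.
have mv : measurable_fun setT v by exact: measurable_funM.
have intv : (\int[lebesgue_rV N]_x (v x)%:E = 1)%E.
  under eq_integral do rewrite EFinM.
  rewrite ge0_integralZr//; last 3 first.
  - exact/measurable_EFinP.
  - by move=> x _; rewrite lee_fin n0.
  - by rewrite lee_fin invr_ge0 ltW.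
  by rewrite -norm_uE -EFinM divff// gt_eqF.
have iv : (lebesgue_rV N).-integrable setT (EFin \o v).
  apply/integrableP; split; first exact/measurable_EFinP.
  rewrite (eq_integral (EFin \o v)) ?intv ?ltry// => x _.
  by rewrite gee0_abs// lee_fin.
(* In dimension [0] the density [v] is the constant [1]. *)
have [N0|N0] := posnP N.
  have Q0 : Q = 0 by rewrite /Q /hom_dim big1// => j _; exfalso; case: j => j; rewrite N0.
  have all_eq x y : x = y :> 'rV[R]_N.
    by apply/rowP => i; exfalso; case: i => i; rewrite N0.
  have leb1 : (lebesgue_rV N [set: 'rV[R]_N] = 1)%E.
    have <- : box_rV 0 0 = [set: 'rV[R]_N].
      by apply/seteqP; split => // x _ i; rewrite (all_eq x 0) lexx.
    rewrite lebesgue_rV_box// big1// => i; exfalso.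
    by case: i => i; rewrite N0.
  have v1 : v 0 = 1.
    apply: EFin_inj; rewrite -intv (eq_integral (cst (v 0)%:E)).
      by rewrite integral_cst// -[LHS]mule1; congr (_ * _)%E; exact/esym/leb1.
    by move=> x _; rewrite (all_eq x 0).
  have h0 x : h x = 0 by rewrite /h (all_eq x 0) v1 invr1 ln1 mulr0.
  split.
    under eq_integral do rewrite h0 maxxx.
    by rewrite integral0 ltry.
  under eq_integral do rewrite h0.
  by rewrite integral0 Q0 !mul0r.
pose M := norm_wu / norm_u.
have intrv : (\int[lebesgue_rV N]_x (rho x * v x)%:E = M%:E)%E.
  under eq_integral do rewrite mulrA EFinM.
  rewrite ge0_integralZr//; last 3 first.
  - by apply/measurable_EFinP; exact: measurable_funM.
  - by move=> x _; rewrite lee_fin mulr_ge0 ?rho0 ?n0.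
  - by rewrite lee_fin invr_ge0 ltW.
  by rewrite -norm_wuE -EFinM.
have irv : (lebesgue_rV N).-integrable setT (fun x => (rho x * v x)%:E).
  apply/integrableP; split; first by apply/measurable_EFinP; exact: measurable_funM.
  rewrite (eq_integral (fun x => (rho x * v x)%:E)) ?intrv ?ltry// => x _.
  by rewrite gee0_abs// lee_fin mulr_ge0.
(* A vanishing mean would force [u] to be supported at the origin, a null set. *)
have M0 : 0 < M.
  rewrite divr_gt0// -lte_fin norm_wuE.
  apply: integral_modulus_gt0 => //.
  apply: filterS (lebesgue_rV_ae_neq0 R N0) => x x0.
  rewrite powR_eq0 (gt_eqF alpha0) andbT; apply: contra x0 => /eqP.
  by move/(qn_eq0 qnP) => ->.
have Q0 : 0 < Q by exact: hom_dim_gt0.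
pose s := ((alpha - 1) * M)^-1.
have s0 : 0 < s by rewrite invr_gt0 mulr_gt0 ?subr_gt0.
pose W x := s `^ (Q / alpha) * (1 + s * rho x) `^ (- Q).
have t0 x : 0 < 1 + s * rho x by rewrite ltr_wpDr// mulr_ge0// ltW.
have W0 x : 0 < W x by rewrite mulr_gt0 ?powR_gt0.
have mW : measurable_fun setT W.
  apply: measurable_funM => //; apply: measurableT_comp (measurable_powR _) _.
  by apply: measurable_funD => //; exact: measurable_funM.
pose I := fine (sigma (quasi_sphere qn)) * Gamma (Q / alpha) *
  Gamma (Q / alpha') / (alpha * Gamma Q).
have WI : (\int[lebesgue_rV N]_x (W x)%:E <= I%:E)%E.
  exact: (radial_weight_integral_le qnP sigmaP).
(* In particular the quasi-sphere has positive measure. *)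
have I0 : 0 < I.
  rewrite -lte_fin (lt_le_trans _ WI)// integral_gt0//.
  - exact/measurable_EFinP.
  - by move=> x _; rewrite lte_fin.
  - exact: lebesgue_rV_setT_neq0.
have sM0 : 0 < 1 + s * M by rewrite ltr_wpDr// mulr_ge0 ?ltW.
pose A := ln I - Q / alpha * ln s + Q * ln (1 + s * M).
pose c := Q * s / (1 + s * M).
have [ivL IvL] := @integral_affine_mean _ _ _ _ v rho A c M iv irv intv intrv.
have -> : Q / alpha * ln (B / norm_u * norm_wu) = A.
  rewrite [RHS](optimal_dilation_value Q0 alpha1 I0 M0); congr (_ * ln _).
  by rewrite /B /B_const -/I /M mulrAC mulrA.
apply: (@gibbs_inequality _ _ _ _ v (fun x => W x / I)
  (fun x => A + c * (rho x - M)) A) => //.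
- exact: measurable_funM.
- by move=> x; rewrite divr_gt0.
- under eq_integral do rewrite EFinM.
  rewrite ge0_integralZr//; last 3 first.
  + exact/measurable_EFinP.
  + by move=> x _; rewrite lee_fin ltW.
  + by rewrite lee_fin invr_ge0 ltW.
  rewrite (@le_trans _ _ (I%:E * I^-1%:E)%E)// ?lee_wpmul2r//.
    by rewrite lee_fin invr_ge0 ltW.
  by rewrite -EFinM divff// gt_eqF.
- move=> x; rewrite ln_div ?posrE// lnM ?posrE ?powR_gt0// !ln_powR.
  have := ln_le_tangent sM0 (t0 x).
  rewrite -(ler_pM2l Q0) => tan.
  rewrite /A /c; rewrite (_ : - (_ - _) =
    ln I - Q / alpha * ln s + Q * ln (1 + s * rho x)); last by ring.
  rewrite -!addrA !lerD2l (le_trans tan)// le_eqVlt; apply/orP; left; apply/eqP.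
  by field; rewrite gt_eqF.
Qed.
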